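(* Let $n\ge 1$, let $\mathcal{T}=(\mathbb{C}^* )^n$, and let $R:\mathcal{T}^2\to\mathcal{T}^2$ be the rational map $R(\mathbf{x},\mathbf{y})=(\mathbf{x}',\mathbf{y}')$ determined by $$x_1'\cdots x_k'=y_1\cdots y_k+\Delta_k(\mathbf{x},\mathbf{y})\,\eta(\mathbf{x},\mathbf{y})\quad (1\le k\le n),\qquad x_i'y_i'=x_iy_i\quad(1\le i\le n).$$ Then $R$ is nondegenerate.
   Context: Elements of $\mathcal{T}=(\mathbb{C}^* )^n$ are written $\mathbf{t}=[t_1,\dots,t_n]$. For $\mathbf{x},\mathbf{y}\in\mathcal{T}$ set $\Delta_1=1$ and, for $k\ge 2$, $$\Delta_k(\mathbf{x},\mathbf{y})=x_1\cdots x_{k-1}+x_1\cdots x_{k-2}y_k+\dots+y_2\cdots y_k=\sum_{j=1}^k x_1\cdots x_{j-1}\,y_{j+1}\cdots y_k,$$ and $$\eta(\mathbf{x},\mathbf{y})=\frac{x_1\cdots x_n-y_1\cdots y_n}{\Delta_n(\mathbf{x},\mathbf{y})}.$$ The displayed conditions determine $R$ uniquely as a rational map, and they imply $\prod_i x_i'=\prod_i x_i$. For an irreducible algebraic variety $X$ over $\mathbb{C}$ and a birational isomorphism $R$ of $X\times X$ to itself, write $R(x,y)=(f_y(x),g_x(y))$; $f_z,g_z:X\to X$ are rational maps, well defined for generic $z\in X$. $R$ is called nondegenerate if $f_z$ and $g_z$ are defined and are birational isomorphisms of $X$ for all $z\in X$. Here $X=\mathcal{T}$. *)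

(* Defs.v *)
From HB Require Import structures.
From mathcomp Require Import all_boot all_order all_algebra.
From mathcomp Require Export reals complex.
From mathcomp Require Export mpoly.

Set Implicit Arguments.
Unset Strict Implicit.
Unset Printing Implicit Defensive.

Import GRing.Theory.
Local Open Scope ring_scope.

Section RationalMaps.
Variable C : fieldType.

(** The function field C(X_0, ..., X_(m-1)) of the torus T^m = (C^* )^m. *)
Definition ratfun (m : nat) := {fraction {mpoly C[m]}}.

Definition cst m (c : C) : ratfun m := tofrac (c%:MP).
Definition coordf m (i : 'I_m) : ratfun m := tofrac 'X_i.

(** A rational map T^m --> T^k is a k-tuple of nonzero rational functions on
    T^m (none of the k coordinates vanishes identically).  Two of them are
    equal as rational maps iff their coordinates are equal in the function
    field. *)
Record ratmap (m k : nat) := RatMap {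
  ratmap_coord :> 'I_k -> ratfun m;
  ratmap_neq0 : forall i, ratmap_coord i != 0
}.

(** p(f_0, ..., f_(m-1)) for a polynomial p. *)
Definition subst_poly m l (f : 'I_m -> ratfun l) (p : {mpoly C[m]}) : ratfun l :=
  mmap (@cst l) f p.

(** [pullback f r s]: r \o f is defined and equal to s, that is, r has a
    representation p / q whose denominator does not vanish identically on the
    image of f (the domain of r meets that image), and s = p(f) / q(f).
    On the torus the coordinates are invertible, so ordinary polynomials p, q
    give the same notion as Laurent polynomials. *)
Definition pullback m l (f : 'I_m -> ratfun l) (r : ratfun m) (s : ratfun l) :=
  exists p q : {mpoly C[m]},
    [/\ r = tofrac p / tofrac q, subst_poly f q != 0
      & s = subst_poly f p / subst_poly f q].

(** g \o f is defined and equal to h. When h is a [ratmap], its coordinates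
    are nonzero, so that f also meets the locus where g takes values in the
    torus. *)
Definition composite m k l (g : 'I_k -> ratfun m) (f : 'I_m -> ratfun l)
    (h : 'I_k -> ratfun l) :=
  forall i, pullback f (g i) (h i).

Definition birational m (f : ratmap m m) :=
  exists g : ratmap m m, composite g f (@coordf m) /\ composite f g (@coordf m).

(** T^n x T^n is T^(n + n): the first n coordinates are those of x
    ([lshift n i]), the last n those of y ([rshift n i]). *)
Definition xvar n (i : 'I_n) : ratfun (n + n) := coordf (lshift n i).
Definition yvar n (i : 'I_n) : ratfun (n + n) := coordf (rshift n i).

Definition fst_part n (R : ratmap (n + n) (n + n)) : 'I_n -> ratfun (n + n) :=
  fun i => R (lshift n i).
Definition snd_part n (R : ratmap (n + n) (n + n)) : 'I_n -> ratfun (n + n) :=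
  fun i => R (rshift n i).

(** The inclusions u |-> (u, z) and u |-> (z, u) of T^n in T^n x T^n. *)
Definition slice_l n (z : 'I_n -> C) (j : 'I_(n + n)) : ratfun n :=
  match split j with inl i => coordf i | inr i => cst n (z i) end.
Definition slice_r n (z : 'I_n -> C) (j : 'I_(n + n)) : ratfun n :=
  match split j with inl i => cst n (z i) | inr i => coordf i end.

(** With R(x, y) = (f_y(x), g_x(y)): R is birational and, for every z in the
    torus, f_z = fst_part R (-, z) and g_z = snd_part R (z, -) are defined and
    birational. *)
Definition nondegenerate_map n (R : ratmap (n + n) (n + n)) :=
  birational R /\
  forall z : 'I_n -> C, (forall i, z i != 0) ->
    (exists f : ratmap n n,
       composite (fst_part R) (slice_l z) f /\ birational f) /\
    (exists g : ratmap n n,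
       composite (snd_part R) (slice_r z) g /\ birational g).

End RationalMaps.

Section Delta.
Variables (K : fieldType) (n : nat).
Implicit Types x y : 'I_n -> K.

(** The product of the first k coordinates. *)
Definition prefix_prod (k : nat) x : K := \prod_(i < n | (i < k)%N) x i.

(** Coordinates are numbered from 0, so that the sum runs over 0 <= j < k; Delta 1 x y = 1. *)
Definition Delta (k : nat) x y : K :=
  \sum_(j < n | (j < k)%N)
     (\prod_(i < n | (i < j)%N) x i) * \prod_(i < n | (j < i < k)%N) y i.

Definition eta x y : K := (prefix_prod n x - prefix_prod n y) / Delta n x y.

End Delta.

(** The conditions that determine R, as identities in the function field. *)
Definition is_geometric_R (C : fieldType) n (R : ratmap C (n + n) (n + n)) :=
  let x := @xvar C n in let y := @yvar C n in
  let x' := fst_part R in let y' := snd_part R in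
  (forall k : nat, (1 <= k <= n)%N ->
     prefix_prod k x' = prefix_prod k y + Delta k x y * eta x y) /\
  (forall i : 'I_n, x' i * y' i = x i * y i).

(* Main.v *)
From HB Require Import structures.
Require Import Defs.
From mathcomp Require Import all_boot all_order all_algebra.
From mathcomp Require Import ring.

(** The quantity Delta_n is one of n cyclic sums D_0, ..., D_(n-1): reading the
    indices of x and y modulo n, D_i is the sum Delta_n that starts at position
    i instead of 0.  Splitting off an end term of such a sum gives the
    recursion ([cyclic_Delta_rec])
<<
      x_i D_(i+1) - y_i D_i = X - Y,      X = prod x_j,  Y = prod y_j,
>>
    and, by induction on k, the conditions defining R become ([R_coord])
<<
      x'_i = x_i D_(i+1) / D_i,           y'_i = y_i D_i / D_(i+1).
>>
    Around the cycle, a recursion a_i d_(i+1) - b_i d_i = c_i has at most one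
    solution d when prod a_i and prod b_i differ ([shift_rec_uniq]).  All the
    inverses come from this uniqueness.

    Birationality of R.  The family D_i(x, y) solves the recursion that
    characterizes D_i(y', x'), so the two agree ([cyclic_Delta_R]).  Hence R
    maps (y', x') to (y, x): R is unitary, its inverse being its conjugate by
    the exchange of the two factors.

    Birationality of x |-> x' for fixed y = z, and of y |-> y' for fixed x = z.
    Both have the form u_i |-> u_i P_(s i) / P_i, where s is the cyclic shift
    (respectively its inverse), P is a family of polynomials in u, and
    u_i P_(s i) - z_i P_i does not depend on i.  The recursion shows that the
    value f_i of such a map satisfies f_i - z_i = (U - Z) / P_i, with
    U = prod u_j and Z = prod z_j, so that u_i is
    f_i (f_(s i) - z_(s i)) / (f_i - z_i): an inverse that does not involve P.
    In the other direction, uniqueness gives P_i = (U - Z) / (u_i - z_i) at the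
    image of u under that inverse ([shift_map_birational]).

    The denominators are nonzero polynomials because at a point where one of
    the two arguments vanishes only one term of D_i survives, and it is a
    product of coordinates of the other argument. *)

Set Implicit Arguments.
Unset Strict Implicit.
Unset Printing Implicit Defensive.

Import GRing.Theory.
Local Open Scope ring_scope.

(** * Delta over an interval of indices *)

Section IntervalDelta.
Variable K : comNzRingType.
Implicit Types a b : nat -> K.

(** A periodic sequence lets an interval wrap around the cycle, so indices
    are natural numbers here. *)
Definition interval_Delta a b (s e : nat) : K :=
  \sum_(s <= j < e) (\prod_(s <= l < j) a l) * \prod_(j.+1 <= l < e) b l.

Lemma interval_DeltaSr a b s e : (s <= e)%N ->
  interval_Delta a b s e.+1 =
    b e * interval_Delta a b s e + \prod_(s <= l < e) a l.
Proof.
move=> les; rewrite /interval_Delta big_nat_recr //=.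
rewrite (@big_geq _ _ _ e.+1 e.+1) // mulr1 big_distrr /=; congr (_ + _).
apply: eq_big_nat => j /andP[_ lje].
by rewrite [in LHS]big_nat_recr //= [RHS]mulrC mulrA.
Qed.

Lemma interval_DeltaSl a b s e : (s < e)%N ->
  interval_Delta a b s e =
    a s * interval_Delta a b s.+1 e + \prod_(s.+1 <= l < e) b l.
Proof.
move=> lse; rewrite /interval_Delta [LHS]big_ltn //.
rewrite (@big_geq _ _ _ s s) // mul1r addrC; congr (_ + _).
rewrite big_distrr /=; apply: eq_big_nat => j /andP[lsj _].
by rewrite (big_ltn lsj) mulrA.
Qed.

End IntervalDelta.

(** * The cyclic sums and their recursion *)

Section CyclicDelta.
Variable m : nat.

Definition cyclic_Delta (K : comNzRingType) (x y : 'I_m.+1 -> K)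
    (i : 'I_m.+1) : K :=
  interval_Delta (x \o inZp) (y \o inZp) i (i + m.+1).

Lemma inZpS (i : 'I_m.+1) : inZp i.+1 = ordS i.
Proof. exact: val_inj. Qed.

Lemma inZp_period l : inZp (l + m.+1) = inZp l :> 'I_m.+1.
Proof. by apply: val_inj; rewrite /= modnDr. Qed.

Lemma interval_Delta_period (K : comNzRingType) (x y : 'I_m.+1 -> K)
    (s e : nat) :
  interval_Delta (x \o inZp) (y \o inZp) (s + m.+1) (e + m.+1) =
  interval_Delta (x \o inZp) (y \o inZp) s e.
Proof.
have prod_period (z : 'I_m.+1 -> K) s' e' :
    \prod_(s' + m.+1 <= l < e' + m.+1) (z \o inZp) l =
    \prod_(s' <= l < e') (z \o inZp) l.
  rewrite big_addn addnK; apply: eq_bigr => l _.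
  by rewrite /= inZp_period.
rewrite /interval_Delta big_addn addnK.
apply: eq_bigr => j _.
by rewrite prod_period -addSn prod_period.
Qed.

(** The bound includes s = m.+1, where the cyclic index wraps to 0 but the
    interval starts one period later. *)
Lemma cyclic_Delta_inZp (K : comNzRingType) (x y : 'I_m.+1 -> K) (s : nat) :
  (s <= m.+1)%N ->
  cyclic_Delta x y (inZp s) =
  interval_Delta (x \o inZp) (y \o inZp) s (s + m.+1).
Proof.
rewrite leq_eqVlt => /predU1P[->|lsm].
  have:= interval_Delta_period x y 0 m.+1; rewrite add0n => ->.
  by rewrite /cyclic_Delta /= modnn.
by rewrite /cyclic_Delta /= modn_small.
Qed.

Lemma prefix_prod_nat (K : fieldType) (x : 'I_m.+1 -> K) k : (k <= m.+1)%N ->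
  prefix_prod k x = \prod_(0 <= l < k) (x \o inZp) l.
Proof.
move=> lek; rewrite big_mkord (big_ord_widen _ (x \o inZp) lek).
by apply: eq_bigr => i _; rewrite /= valZpK.
Qed.

Lemma prod_inZp (K : comNzRingType) (x : 'I_m.+1 -> K) :
  \prod_(0 <= l < m.+1) (x \o inZp) l = \prod_i x i.
Proof. by rewrite big_mkord; apply: eq_bigr => i _; rewrite /= valZpK. Qed.

Lemma prod_window (K : comNzRingType) (x : 'I_m.+1 -> K) (s : nat) :
  x (inZp s) * \prod_(s.+1 <= l < s + m.+1) (x \o inZp) l = \prod_i x i.
Proof.
rewrite -[RHS]prod_inZp; elim: s => [|s IHs].
  by rewrite add0n [RHS]big_ltn.
have les : (s < s + m.+1)%N by rewrite addnS ltnS leq_addr.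
have <- : \prod_(s.+1 <= l < (s + m.+1).+1) (x \o inZp) l =
    x (inZp s.+1) * \prod_(s.+2 <= l < s.+1 + m.+1) (x \o inZp) l.
  by rewrite big_ltn.
by rewrite -{}IHs big_nat_recr //= inZp_period mulrC.
Qed.

(** Both cyclic sums are obtained from one sum over the n - 1 positions strictly
    between i and i + n, by adding the position i + n on the right, or i on the
    left.  The contributions of the inner sum cancel. *)
Lemma cyclic_Delta_rec (K : comNzRingType) (x y : 'I_m.+1 -> K) (i : 'I_m.+1) :
  x i * cyclic_Delta x y (ordS i) - y i * cyclic_Delta x y i =
  \prod_i x i - \prod_i y i.
Proof.
rewrite -inZpS cyclic_Delta_inZp ?ltn_ord //  addSn.
rewrite interval_DeltaSr; last by rewrite addnS ltnS leq_addr.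
rewrite /cyclic_Delta [interval_Delta _ _ i _]interval_DeltaSl; last first.
  by rewrite addnS ltnS leq_addr.
rewrite -(prod_window x i) -(prod_window y i) /= inZp_period !valZpK.
by ring.
Qed.

Lemma Delta_interval (K : fieldType) (x y : 'I_m.+1 -> K) k : (k <= m.+1)%N ->
  Delta k x y = interval_Delta (x \o inZp) (y \o inZp) 0 k.
Proof.
move=> lek; rewrite /interval_Delta big_mkord.
pose F j := (\prod_(0 <= l < j) (x \o inZp) l) *
  \prod_(j.+1 <= l < k) (y \o inZp) l.
rewrite (big_ord_widen _ F lek); apply: eq_bigr => j ltjk; congr (_ * _).
  by rewrite -prefix_prod_nat // ltnW.
pose G l := (y \o inZp) l.
rewrite -/G big_geq_mkord (big_ord_widen_cond _ (fun l => (j < l)%N) G lek).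
by apply: eq_bigr => i _; rewrite /G /= valZpK.
Qed.

(** The right-hand side, divided by Delta_n, is the value that the definition
    of R prescribes for the product of the first k coordinates of x'. *)
Lemma cyclic_Delta_prefix (K : fieldType) (x y : 'I_m.+1 -> K) k :
  (k <= m.+1)%N ->
  prefix_prod k x * cyclic_Delta x y (inZp k) =
  prefix_prod k y * cyclic_Delta x y ord0 +
    Delta k x y * (\prod_i x i - \prod_i y i).
Proof.
elim: k => [_|k IHk ltkm].
  rewrite !prefix_prod_nat // Delta_interval // /interval_Delta !big_geq //.
  by rewrite mul0r addr0; congr (_ * cyclic_Delta _ _ _); apply: val_inj.
have := IHk (ltnW ltkm).
rewrite !prefix_prod_nat ?(ltnW ltkm) // !Delta_interval ?(ltnW ltkm) //.
rewrite !big_nat_recr //= interval_DeltaSr //= => IH.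
have := cyclic_Delta_rec x y (inZp k).
rewrite -inZpS /= modn_small // => rec.
set X := \prod_(0 <= _ < _) _ in IH *; set Y := \prod_(0 <= _ < _) _ in IH *.
transitivity (X * (x (inZp k) * cyclic_Delta x y (inZp k.+1) -
   y (inZp k) * cyclic_Delta x y (inZp k)) + 
   y (inZp k) * (X * cyclic_Delta x y (inZp k))); first by ring.
by rewrite rec IH; ring.
Qed.

Lemma cyclic_Delta_x0 (K : fieldType) (x y : 'I_m.+1 -> K) i :
  (forall j, x j = 0) -> (forall j, y j != 0) -> cyclic_Delta x y i != 0.
Proof.
move=> x0 y_neq0; rewrite /cyclic_Delta interval_DeltaSl; last first.
  by rewrite addnS ltnS leq_addr.
by rewrite /= x0 mul0r add0r prodf_seq_neq0; apply/allP => l _ /=.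
Qed.

Lemma cyclic_Delta_y0 (K : fieldType) (x y : 'I_m.+1 -> K) i :
  (forall j, y j = 0) -> (forall j, x j != 0) -> cyclic_Delta x y i != 0.
Proof.
move=> y0 x_neq0; rewrite /cyclic_Delta addnS interval_DeltaSr ?leq_addr //.
by rewrite /= y0 mul0r add0r prodf_seq_neq0; apply/allP => l _ /=.
Qed.

Lemma rmorph_cyclic_Delta (K L : comNzRingType) (phi : {rmorphism K -> L})
    (x y : 'I_m.+1 -> K) i :
  phi (cyclic_Delta x y i) = cyclic_Delta (phi \o x) (phi \o y) i.
Proof.
rewrite /cyclic_Delta /interval_Delta rmorph_sum; apply: eq_bigr => j _.
by rewrite rmorphM !rmorph_prod.
Qed.

Lemma eq_cyclic_Delta (K : comNzRingType) (x x' y y' : 'I_m.+1 -> K) :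
  x =1 x' -> y =1 y' -> cyclic_Delta x y =1 cyclic_Delta x' y'.
Proof.
move=> eqx eqy i; apply: eq_bigr => j _.
by congr (_ * _); apply: eq_bigr => l _ /=; rewrite (eqx, eqy).
Qed.

(** Invariance is two-sided (an equality of booleans), so that the statement
    passes from a shift to its inverse. *)
Lemma ordS_transitive (A : pred 'I_m.+1) i0 : A i0 ->
  (forall i, A (ordS i) = A i) -> forall i, A i.
Proof.
move=> Ai0 invA.
have invZp k : A (inZp k) = A ord0.
  elim: k => [|k <-]; first by congr A; apply: val_inj.
  rewrite -[RHS]invA; congr A; apply: val_inj.
  by rewrite /= -[in LHS]addn1 -[in RHS]addn1 modnDml.
by move=> i; rewrite -(valZpK i) invZp -(invZp i0) valZpK.
Qed.
End CyclicDelta.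


(** * Recursions along a cyclic shift *)

Section Uniqueness.
Variables (n : nat) (s : 'I_n -> 'I_n).

Definition transitive_shift :=
  forall (A : pred 'I_n) i0, A i0 -> (forall i, A (s i) = A i) -> forall i, A i.

(** The difference e of two solutions satisfies a_i e_(s i) = b_i e_i.
    Multiplying over the cycle gives prod a * prod e = prod b * prod e, so some
    e_i vanishes, and a zero propagates along s in both directions. *)
Lemma shift_rec_uniq (K : fieldType) (a b c d d' : 'I_n -> K) :
  injective s -> transitive_shift ->
  (forall i, a i != 0) -> (forall i, b i != 0) ->
  \prod_i a i != \prod_i b i ->
  (forall i, a i * d (s i) - b i * d i = c i) ->
  (forall i, a i * d' (s i) - b i * d' i = c i) -> d =1 d'.
Proof.
move=> s_inj s_trans a_neq0 b_neq0 neq_ab rec rec'.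
pose e i := d i - d' i.
have rec_e i : a i * e (s i) = b i * e i.
  apply/eqP; rewrite -subr_eq0 /e; apply/eqP.
  transitivity (a i * d (s i) - b i * d i - (a i * d' (s i) - b i * d' i)).
    by ring.
  by rewrite rec rec' subrr.
have prod_e : \prod_i e i = 0.
  have: \prod_i a i * \prod_i e i = \prod_i b i * \prod_i e i.
    transitivity (\prod_i a i * \prod_i e (s i)).
      by congr (_ * _); rewrite [LHS](reindex_inj s_inj).
    by rewrite -!big_split; apply: eq_bigr => i _; exact: rec_e.
  move/eqP; rewrite -subr_eq0 -mulrBl mulf_eq0 subr_eq0 (negbTE neq_ab) /=.
  by move/eqP.
have /eqP/prodf_eq0[i0 _ ei0] := prod_e.
have e0 : forall i, e i == 0.
  apply: (s_trans [pred i | e i == 0] i0) => //= i.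
  have := congr1 (eq_op^~ 0) (rec_e i).
  by rewrite !mulf_eq0 (negbTE (a_neq0 i)) (negbTE (b_neq0 i)).
by move=> i; apply/eqP; rewrite -subr_eq0; exact: e0.
Qed.

Section ShiftAlgebra.
Variables (K : fieldType) (u z : 'I_n -> K).
Hypotheses (s_inj : injective s) (s_trans : transitive_shift).

Definition shift_map (p : 'I_n -> K) i := u i * p (s i) / p i.

Lemma prod_shift_map p : (forall i, p i != 0) ->
  \prod_i shift_map p i = \prod_i u i.
Proof.
move=> p_neq0; rewrite big_split big_split /= prodfV.
rewrite [X in _ / X](reindex_inj s_inj).
by apply: mulfK; apply/prodf_neq0 => i _; exact: p_neq0.
Qed.

Lemma shift_map_neq0 p i : (forall i, u i != 0) -> (forall i, p i != 0) ->
  shift_map p i != 0.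
Proof. by move=> u_neq0 p_neq0; rewrite !mulf_neq0 ?invr_eq0. Qed.

Lemma shift_map_sub p c i : p i != 0 -> u i * p (s i) - z i * p i = c ->
  shift_map p i - z i = c / p i.
Proof. by move=> p_neq0 <-; rewrite /shift_map mulrBl mulfK. Qed.

(** The left-hand side is the inverse map, [shift_map] of the family u - z,
    applied to the image of u. *)
Lemma shift_mapK p c i : (forall i, p i != 0) -> c != 0 ->
  (forall i, u i * p (s i) - z i * p i = c) ->
  shift_map p i * (shift_map p (s i) - z (s i)) / (shift_map p i - z i) = u i.
Proof.
move=> p_neq0 c_neq0 rec.
rewrite !(shift_map_sub (p_neq0 _) (rec _)) /shift_map.
by field; rewrite !p_neq0 c_neq0.
Qed.

Let h := shift_map (fun i => u i - z i).
Hypotheses (u_neq0 : forall i, u i != 0) (z_neq0 : forall i, z i != 0).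
Hypotheses (uz_neq0 : forall i, u i - z i != 0).
Hypothesis neq_UZ : \prod_i u i - \prod_i z i != 0.

(** The family on the right solves the same recursion, because h preserves the
    product of the coordinates. *)
Lemma shift_map_inv_rec d i :
  (forall i, h i * d (s i) - z i * d i = \prod_i h i - \prod_i z i) ->
  d i = (\prod_i u i - \prod_i z i) / (u i - z i).
Proof.
rewrite prod_shift_map // => rec.
apply: (shift_rec_uniq (c := fun=> \prod_i u i - \prod_i z i)
  (d' := fun i => _ / (u i - z i)) s_inj s_trans _ z_neq0 _ rec).
- by move=> j; rewrite !mulf_neq0 ?invr_eq0.
- by rewrite prod_shift_map // -subr_eq0.
- by move=> j /=; rewrite /h /shift_map; field; rewrite !uz_neq0.
Qed.

Lemma shift_map_invK d i :
  (forall i, h i * d (s i) - z i * d i = \prod_i h i - \prod_i z i) ->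
  h i * d (s i) / d i = u i.
Proof.
move=> rec; rewrite !(shift_map_inv_rec _ rec) /h /shift_map.
by field; rewrite neq_UZ !uz_neq0.
Qed.

End ShiftAlgebra.
End Uniqueness.

(** * Substitution in polynomials and nonvanishing *)

Section Substitution.
Variable C : fieldType.

HB.instance Definition _ (m : nat) :=
  GRing.RMorphism.copy (@cst C m) (@tofrac _ \o @mpolyC m C).
HB.instance Definition _ (m l : nat) (f : 'I_m -> ratfun C l) :=
  GRing.RMorphism.copy (subst_poly f) (mmap (@cst C l) f).

Lemma subst_polyX m l (f : 'I_m -> ratfun C l) i : subst_poly f 'X_i = f i.
Proof. by rewrite /subst_poly mmapX mmap1U. Qed.

Lemma subst_polyC m l (f : 'I_m -> ratfun C l) c :
  subst_poly f c%:MP = cst l c.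
Proof. exact: mmapC. Qed.

Lemma prodX_subC_neq0 n (z : 'I_n -> C) : (0 < n)%N -> (forall i, z i != 0) ->
  \prod_i 'X_i - \prod_i (z i)%:MP != 0 :> {mpoly C[n]}.
Proof.
case: n z => // n z _ z_neq0; apply/eqP.
move/(congr1 (meval (fun _ => 0))); rewrite rmorphB !rmorph_prod rmorph0 /=.
rewrite big_ord_recl /= mevalXU mul0r sub0r => /eqP; rewrite oppr_eq0.
by apply/negP/prodf_neq0 => i _; rewrite /= mevalC.
Qed.

Lemma X_subC_neq0 n (i : 'I_n) (c : C) : 'X_i - c%:MP != 0 :> {mpoly C[n]}.
Proof.
apply/eqP => /(congr1 (meval (fun _ => 1 + c))); rewrite rmorphB rmorph0 /=.
by rewrite mevalXU mevalC addrK => /eqP; rewrite oner_eq0.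
Qed.

Lemma X_neq0 n (i : 'I_n) : 'X_i != 0 :> {mpoly C[n]}.
Proof. by have := X_subC_neq0 i 0; rewrite rmorph0 subr0. Qed.

Lemma coordf_neq0 n (i : 'I_n) : coordf C i != 0.
Proof. by rewrite tofrac_eq0 X_neq0. Qed.

(** * Birationality of the shift maps *)

Section ShiftMap.
Variables (n : nat) (s : 'I_n -> 'I_n) (z : 'I_n -> C).
Variables (P : 'I_n -> {mpoly C[n]}) (f : ratmap C n n).
Hypotheses (n_gt0 : (0 < n)%N) (z_neq0 : forall i, z i != 0).
Hypotheses (s_inj : injective s) (s_trans : transitive_shift s).
Hypothesis P_neq0 : forall i, P i != 0.
Hypothesis P_rec : forall i,
  'X_i * P (s i) - (z i)%:MP * P i = \prod_j 'X_j - \prod_j (z j)%:MP.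
Hypothesis fE : forall i, f i = tofrac ('X_i * P (s i)) / tofrac (P i).


Let u := @coordf C n.
Let w i := cst n (z i).
Let e i : ratfun C n := u i - w i.
Let p i : ratfun C n := tofrac (P i).

Let p_neq0 i : p i != 0. Proof. by rewrite tofrac_eq0. Qed.
Let u_neq0 i : u i != 0. Proof. exact: coordf_neq0. Qed.
Let w_neq0 i : w i != 0. Proof. by rewrite tofrac_eq0 mpolyC_eq0. Qed.
Let e_neq0 i : e i != 0.
Proof. by rewrite /e -tofracB tofrac_eq0 X_subC_neq0. Qed.

Let uwE : \prod_i u i - \prod_i w i =
  tofrac (\prod_i 'X_i - \prod_i (z i)%:MP).
Proof. by rewrite tofracB !rmorph_prod. Qed.

Let uw_neq0 : \prod_i u i - \prod_i w i != 0.
Proof. by rewrite uwE tofrac_eq0 prodX_subC_neq0. Qed.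

Let p_rec i : u i * p (s i) - w i * p i = \prod_i u i - \prod_i w i.
Proof. by rewrite uwE -(P_rec i) tofracB !tofracM. Qed.

Let fE' i : f i = shift_map s u p i.
Proof. by rewrite fE tofracM. Qed.

Let h_neq0 i : shift_map s u e i != 0.
Proof. exact: (shift_map_neq0 s i u_neq0 e_neq0). Qed.
Let h : ratmap C n n := RatMap h_neq0.

Let d i := subst_poly h (P i).

Let h_rec i : h i * d (s i) - w i * d i =
  \prod_i h i - \prod_i w i.
Proof.
have := congr1 (subst_poly h) (P_rec i).
rewrite !rmorphB !rmorphM !rmorph_prod [LHS]/= subst_polyX subst_polyC => ->.
congr (_ - _); apply: eq_bigr => k _; first exact: subst_polyX.
exact: subst_polyC.
Qed.

Lemma shift_map_birational : birational f.
Proof.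
exists h; split=> i.
  exists ('X_i * ('X_(s i) - (z (s i))%:MP)), ('X_i - (z i)%:MP).
  have subE j : subst_poly f ('X_j - (z j)%:MP) = f j - w j.
    by rewrite rmorphB [LHS]/= subst_polyX subst_polyC.
  split.
  - by rewrite tofracM !tofracB.
  - rewrite subE fE' (shift_map_sub (p_neq0 i) (p_rec i)).
    by rewrite mulf_neq0 ?invr_eq0.
  - rewrite [X in _ = X / _](rmorphM (subst_poly f)) [in RHS]/=.
    by rewrite !subE subst_polyX !fE' (shift_mapK _ p_neq0 uw_neq0 p_rec).
have dE := shift_map_inv_rec s_inj s_trans u_neq0 w_neq0 e_neq0 uw_neq0 _ h_rec.
have hK := shift_map_invK s_inj s_trans u_neq0 w_neq0 e_neq0 uw_neq0 _ h_rec.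
exists ('X_i * P (s i)), (P i); split.
- exact: fE.
- by rewrite -/(d i) dE (mulf_neq0 uw_neq0 (invr_neq0 (e_neq0 i))).
- rewrite [X in _ = X / _](rmorphM (subst_poly h)) [in RHS]/= subst_polyX.
  by symmetry; exact: hK.
Qed.
End ShiftMap.

(** * The map R in coordinates *)

Section GeometricR.
Variable m : nat.
Local Notation N := m.+1.
Local Notation D := cyclic_Delta.

Definition R_fst (K : fieldType) (x y : 'I_N -> K) i :=
  x i * D x y (ordS i) / D x y i.
Definition R_snd (K : fieldType) (x y : 'I_N -> K) i :=
  y i * D x y i / D x y (ordS i).

Lemma eq_R_fst (K : fieldType) (x x' y y' : 'I_N -> K) :
  x =1 x' -> y =1 y' -> R_fst x y =1 R_fst x' y'.
Proof. by move=> eqx eqy i; rewrite /R_fst eqx !(eq_cyclic_Delta eqx eqy). Qed.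

Lemma eq_R_snd (K : fieldType) (x x' y y' : 'I_N -> K) :
  x =1 x' -> y =1 y' -> R_snd x y =1 R_snd x' y'.
Proof. by move=> eqx eqy i; rewrite /R_snd eqy !(eq_cyclic_Delta eqx eqy). Qed.

Section FieldIdentities.
Variables (K : fieldType) (x y : 'I_N -> K).
Hypotheses (x_neq0 : forall i, x i != 0) (y_neq0 : forall i, y i != 0).
Hypothesis D_neq0 : forall i, D x y i != 0.

Lemma R_fst_neq0 i : R_fst x y i != 0.
Proof. by rewrite !mulf_neq0 ?invr_eq0. Qed.

Lemma R_snd_neq0 i : R_snd x y i != 0.
Proof. by rewrite !mulf_neq0 ?invr_eq0. Qed.

Lemma prefix_prodS (z : 'I_N -> K) (i : 'I_N) :
  prefix_prod i.+1 z = prefix_prod i z * z i.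
Proof.
by rewrite !prefix_prod_nat ?(ltnW (ltn_ord i)) // big_nat_recr //= valZpK.
Qed.

(** The coordinate x'_i is the quotient of two consecutive prefix products. *)
Lemma R_coord (x' y' : 'I_N -> K) : (forall i, x' i != 0) ->
  (forall k : nat, (1 <= k <= N)%N ->
     prefix_prod k x' = prefix_prod k y + Delta k x y * eta x y) ->
  (forall i : 'I_N, x' i * y' i = x i * y i) ->
  x' =1 R_fst x y /\ y' =1 R_snd x y.
Proof.
move=> x'_neq0 prefix_x' prod_x'y'.
have prefixE k : (k <= N)%N ->
    prefix_prod k x' = prefix_prod k x * D x y (inZp k) / D x y ord0.
  move=> lek; rewrite cyclic_Delta_prefix //.
  have -> : prefix_prod k x' = prefix_prod k y + Delta k x y * eta x y.
    case: k lek => [_|k lek]; last exact: prefix_x'.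
    by rewrite Delta_interval // /interval_Delta !prefix_prod_nat // !big_geq //
      mul0r addr0.
  rewrite /eta !prefix_prod_nat // !prod_inZp.
  rewrite !Delta_interval //.
  rewrite -[interval_Delta _ _ 0 N]/(D x y ord0).
  by field; rewrite D_neq0.
have x'E : x' =1 R_fst x y.
  move=> i; have := prefixE i.+1 (ltn_ord i).
  rewrite !prefix_prodS prefixE ?(ltnW (ltn_ord i)) // inZpS valZpK.
  have xi_neq0 : prefix_prod i x != 0 by apply/prodf_neq0 => j _.
  move=> eq_i; apply: (mulfI (x := prefix_prod i x * D x y i / D x y ord0)).
    by rewrite !mulf_neq0 ?invr_eq0.
  by rewrite eq_i /R_fst; field; rewrite !D_neq0.
split=> // i; apply: (mulfI (x'_neq0 i)); rewrite prod_x'y' x'E /R_fst /R_snd.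
by field; rewrite !D_neq0.
Qed.

Hypothesis neq_XY : \prod_i x i - \prod_i y i != 0.

(** The recursion for the left-hand side has coefficients y' and x' and constant
    Y - X.  It holds for D x y because y'_i D_(i+1) = y_i D_i and
    x'_i D_i = x_i D_(i+1). *)
Lemma cyclic_Delta_R : D (R_snd x y) (R_fst x y) =1 D x y.
Proof.
have prod_fst : \prod_i R_fst x y i = \prod_i x i.
  exact: (@prod_shift_map _ _ _ x (@ordS_inj N) _ D_neq0).
have prod_snd : \prod_i R_snd x y i = \prod_i y i.
  rewrite -(@prod_shift_map _ (@ordS N) K y (@ordS_inj N)
    (fun i => (D x y i)^-1)).
    by apply: eq_bigr => i _; rewrite /R_snd /shift_map invrK mulrAC.
  by move=> i; rewrite invr_eq0.
apply: (@shift_rec_uniq N (@ordS N) K (R_snd x y) (R_fst x y)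
  (fun=> \prod_i y i - \prod_i x i) _ _ (@ordS_inj N) (@ordS_transitive m)).
- exact: R_snd_neq0.
- exact: R_fst_neq0.
- by rewrite prod_fst prod_snd eq_sym -subr_eq0.
- by move=> i; rewrite cyclic_Delta_rec prod_fst prod_snd.
- move=> i; rewrite -[RHS]opprB -(cyclic_Delta_rec x y i) /R_snd /R_fst.
  by field; rewrite !D_neq0.
Qed.

Lemma R_fst_unitary : R_fst (R_snd x y) (R_fst x y) =1 y.
Proof.
move=> i; rewrite /R_fst -/(R_fst x y) !cyclic_Delta_R /R_snd.
by field; rewrite !D_neq0.
Qed.

Lemma R_snd_unitary : R_snd (R_snd x y) (R_fst x y) =1 x.
Proof.
move=> i; rewrite /R_snd -/(R_snd x y) !cyclic_Delta_R /R_fst.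
by field; rewrite !D_neq0.
Qed.

End FieldIdentities.

(** * Substitution in R *)

Section Pullback.
Variables (k l : nat) (f : 'I_k -> ratfun C l) (X Y : 'I_N -> {mpoly C[k]}).
Let a i := subst_poly f (X i).
Let b i := subst_poly f (Y i).
Hypothesis D_neq0 : forall i, D a b i != 0.

Lemma pullback_R_fst i :
  pullback f (R_fst (@tofrac _ \o X) (@tofrac _ \o Y) i) (R_fst a b i).
Proof.
exists (X i * D X Y (ordS i)), (D X Y i).
rewrite [subst_poly f (_ * _)](rmorphM (subst_poly f)) [tofrac (_ * _)]tofracM.
rewrite !(rmorph_cyclic_Delta (subst_poly f)).
by rewrite !(rmorph_cyclic_Delta (@tofrac _)); split=> //; exact: D_neq0.
Qed.

Lemma pullback_R_snd i :
  pullback f (R_snd (@tofrac _ \o X) (@tofrac _ \o Y) i) (R_snd a b i).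
Proof.
exists (Y i * D X Y i), (D X Y (ordS i)).
rewrite [subst_poly f (_ * _)](rmorphM (subst_poly f)) [tofrac (_ * _)]tofracM.
rewrite !(rmorph_cyclic_Delta (subst_poly f)).
by rewrite !(rmorph_cyclic_Delta (@tofrac _)); split=> //; exact: D_neq0.
Qed.
End Pullback.

(** Reduces nonvanishing of a cyclic sum of polynomials to one value. *)
Lemma cyclic_Delta_meval k (X Y : 'I_N -> {mpoly C[k]}) (v : 'I_k -> C) i :
  D (meval v \o X) (meval v \o Y) i != 0 -> D X Y i != 0.
Proof.
rewrite -(rmorph_cyclic_Delta (meval v)); apply: contra_neq => ->.
exact: rmorph0.
Qed.

Lemma split_lshift p q (i : 'I_p) : split (lshift q i) = inl i.
Proof. exact: (unsplitK (inl i)). Qed.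

Lemma split_rshift p q (i : 'I_q) : split (rshift p i) = inr i.
Proof. exact: (unsplitK (inr i)). Qed.

(** * The slices of R *)

Section Slices.
Variable z : 'I_N -> C.
Hypothesis z_neq0 : forall i, z i != 0.
Let Z i : {mpoly C[N]} := (z i)%:MP.
Let U i : {mpoly C[N]} := 'X_i.
Let w i := cst N (z i).

Let w_neq0 i : w i != 0. Proof. by rewrite tofrac_eq0 mpolyC_eq0. Qed.

Lemma cyclic_Delta_XC_neq0 i : D U Z i != 0.
Proof.
apply: (@cyclic_Delta_meval _ _ _ (fun _ => 0)); apply: cyclic_Delta_x0 => j /=.
  exact: mevalXU.
by rewrite mevalC.
Qed.

Lemma cyclic_Delta_CX_neq0 i : D Z U i != 0.
Proof.
apply: (@cyclic_Delta_meval _ _ _ (fun _ => 0)); apply: cyclic_Delta_y0 => j /=.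
  exact: mevalXU.
by rewrite mevalC.
Qed.

Let D_coordE i : D (@coordf C N) w i = tofrac (D U Z i).
Proof. by rewrite (rmorph_cyclic_Delta (@tofrac _)). Qed.

Let D_Ecoord i : D w (@coordf C N) i = tofrac (D Z U i).
Proof. by rewrite (rmorph_cyclic_Delta (@tofrac _)). Qed.

Lemma cyclic_Delta_slice_l_neq0 i : D (@coordf C N) w i != 0.
Proof. by rewrite D_coordE tofrac_eq0 cyclic_Delta_XC_neq0. Qed.

Lemma cyclic_Delta_slice_r_neq0 i : D w (@coordf C N) i != 0.
Proof. by rewrite D_Ecoord tofrac_eq0 cyclic_Delta_CX_neq0. Qed.

Definition fst_slice : ratmap C N N :=
  RatMap (R_fst_neq0 (@coordf_neq0 N) cyclic_Delta_slice_l_neq0).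
Definition snd_slice : ratmap C N N :=
  RatMap (R_snd_neq0 (@coordf_neq0 N) cyclic_Delta_slice_r_neq0).

Lemma fst_slice_birational : birational fst_slice.
Proof.
apply: (@shift_map_birational N (@ordS N) z (D U Z)) => //.
- exact: ordS_inj.
- exact: ordS_transitive.
- exact: cyclic_Delta_XC_neq0.
- by move=> i; rewrite (cyclic_Delta_rec U Z).
- by move=> i; rewrite /= /R_fst !D_coordE tofracM.
Qed.

(** Fixing the first argument exchanges the roles of the two products in the
    recursion: the shift runs backwards, and P_i is D_(i+1). *)
Lemma snd_slice_birational : birational snd_slice.
Proof.
apply: (@shift_map_birational N (@ord_pred N) z (D Z U \o @ordS N)) => //.
- exact: ord_pred_inj.
- move=> A i0 Ai0 invA; apply: (ordS_transitive Ai0) => i.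
  by rewrite -invA ordSK.
- by move=> i; exact: cyclic_Delta_CX_neq0.
- move=> i; rewrite /= ord_predK -[RHS]opprB -(cyclic_Delta_rec Z U i) opprB.
  by [].
- by move=> i; rewrite /= /R_snd !D_Ecoord tofracM ord_predK.
Qed.

Lemma fst_slice_composite :
  composite (R_fst (@xvar C N) (@yvar C N)) (slice_l z) fst_slice.
Proof.
move=> i; have xE j : subst_poly (slice_l z) 'X_(lshift N j) = coordf C j.
  by rewrite subst_polyX /slice_l split_lshift.
have yE j : subst_poly (slice_l z) 'X_(rshift N j) = w j.
  by rewrite subst_polyX /slice_l split_rshift.
rewrite /= -(eq_R_fst xE yE); apply: pullback_R_fst => j.
by rewrite (eq_cyclic_Delta xE yE) cyclic_Delta_slice_l_neq0.
Qed.

Lemma snd_slice_composite :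
  composite (R_snd (@xvar C N) (@yvar C N)) (slice_r z) snd_slice.
Proof.
move=> i; have xE j : subst_poly (slice_r z) 'X_(lshift N j) = w j.
  by rewrite subst_polyX /slice_r split_lshift.
have yE j : subst_poly (slice_r z) 'X_(rshift N j) = coordf C j.
  by rewrite subst_polyX /slice_r split_rshift.
rewrite /= -(eq_R_snd xE yE); apply: pullback_R_snd => j.
by rewrite (eq_cyclic_Delta xE yE) cyclic_Delta_slice_r_neq0.
Qed.
End Slices.

(** * The inverse of R *)

Let x := @xvar C N.
Let y := @yvar C N.
Let X (i : 'I_N) : {mpoly C[N + N]} := 'X_(lshift N i).
Let Y (i : 'I_N) : {mpoly C[N + N]} := 'X_(rshift N i).

(* The point x = 0, y = 1, where no denominator vanishes *)
Let zero_one (j : 'I_(N + N)) : C := if split j is inl _ then 0 else 1.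

Let X_zero_one i : meval zero_one (X i) = 0.
Proof. by rewrite mevalXU /zero_one split_lshift. Qed.

Let Y_zero_one i : meval zero_one (Y i) = 1.
Proof. by rewrite mevalXU /zero_one split_rshift. Qed.

Lemma D_xy_neq0 i : D x y i != 0.
Proof.
rewrite -(rmorph_cyclic_Delta (@tofrac _) X Y) tofrac_eq0.
apply: (cyclic_Delta_meval (v := zero_one)).
apply: cyclic_Delta_x0 => j /=; first exact: X_zero_one.
by rewrite Y_zero_one oner_neq0.
Qed.

Lemma D_yx_neq0 i : D y x i != 0.
Proof.
rewrite -(rmorph_cyclic_Delta (@tofrac _) Y X) tofrac_eq0.
apply: (cyclic_Delta_meval (v := zero_one)).
apply: cyclic_Delta_y0 => j /=; first exact: X_zero_one.
by rewrite Y_zero_one oner_neq0.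
Qed.

Lemma prod_xy_neq : \prod_i x i - \prod_i y i != 0.
Proof.
have -> : \prod_i x i - \prod_i y i = tofrac (\prod_i X i - \prod_i Y i).
  by rewrite tofracB !rmorph_prod.
rewrite tofrac_eq0; apply/eqP => /(congr1 (meval zero_one)).
rewrite rmorphB !rmorph_prod rmorph0 /=.
rewrite [X in _ - X]big1; last by move=> i _; exact: Y_zero_one.
rewrite big_ord_recl X_zero_one mul0r sub0r => /eqP.
by rewrite oppr_eq0 oner_eq0.
Qed.

Lemma prod_yx_neq : \prod_i y i - \prod_i x i != 0.
Proof. by rewrite -opprB oppr_eq0 prod_xy_neq. Qed.

Let x_neq0 i : x i != 0. Proof. exact: coordf_neq0. Qed.
Let y_neq0 i : y i != 0. Proof. exact: coordf_neq0. Qed.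

(** The conjugate of R by the exchange of the two factors. *)
Let Rinv_coord (j : 'I_(N + N)) : ratfun C (N + N) :=
  match split j with inl i => R_snd y x i | inr i => R_fst y x i end.

Let Rinv_neq0 j : Rinv_coord j != 0.
Proof.
rewrite /Rinv_coord; case: (split j) => i.
  exact: (R_snd_neq0 x_neq0 D_yx_neq0).
exact: (R_fst_neq0 y_neq0 D_yx_neq0).
Qed.

Let Rinv : ratmap C (N + N) (N + N) := RatMap Rinv_neq0.

Section Main.
Variable R : ratmap C (N + N) (N + N).
Hypothesis R_lshift : forall i, R (lshift N i) = R_fst x y i.
Hypothesis R_rshift : forall i, R (rshift N i) = R_snd x y i.

Let Rinv_lshift i : Rinv (lshift N i) = R_snd y x i.
Proof. by rewrite /= /Rinv_coord split_lshift. Qed.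

Let Rinv_rshift i : Rinv (rshift N i) = R_fst y x i.
Proof. by rewrite /= /Rinv_coord split_rshift. Qed.

Lemma R_birational : birational R.
Proof.
exists Rinv; split=> j.
  have XE i : subst_poly R (X i) = R_fst x y i by rewrite subst_polyX.
  have YE i : subst_poly R (Y i) = R_snd x y i by rewrite subst_polyX.
  have D_neq0 i : D (subst_poly R \o Y) (subst_poly R \o X) i != 0.
    by rewrite (eq_cyclic_Delta YE XE)
      (cyclic_Delta_R x_neq0 y_neq0 D_xy_neq0 prod_xy_neq) D_xy_neq0.
  rewrite -(splitK j); case: (split j) => i; rewrite [unsplit _]/=.
    rewrite Rinv_lshift.
    rewrite -[coordf C _](R_snd_unitary x_neq0 y_neq0 D_xy_neq0 prod_xy_neq).
    by rewrite -(eq_R_snd YE XE); exact: pullback_R_snd.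
  rewrite Rinv_rshift.
  rewrite -[coordf C _](R_fst_unitary x_neq0 y_neq0 D_xy_neq0 prod_xy_neq).
  by rewrite -(eq_R_fst YE XE); exact: pullback_R_fst.
have XE i : subst_poly Rinv (X i) = R_snd y x i by rewrite subst_polyX.
have YE i : subst_poly Rinv (Y i) = R_fst y x i by rewrite subst_polyX.
have D_neq0 i : D (subst_poly Rinv \o X) (subst_poly Rinv \o Y) i != 0.
  by rewrite (eq_cyclic_Delta XE YE)
    (cyclic_Delta_R y_neq0 x_neq0 D_yx_neq0 prod_yx_neq) D_yx_neq0.
rewrite -(splitK j); case: (split j) => i; rewrite [unsplit _]/=.
  rewrite R_lshift.
  rewrite -[coordf C _](R_fst_unitary y_neq0 x_neq0 D_yx_neq0 prod_yx_neq).
  by rewrite -(eq_R_fst XE YE); exact: pullback_R_fst.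
rewrite R_rshift.
rewrite -[coordf C _](R_snd_unitary y_neq0 x_neq0 D_yx_neq0 prod_yx_neq).
by rewrite -(eq_R_snd XE YE); exact: pullback_R_snd.
Qed.
End Main.

Lemma geometric_R_nondegenerate (R : ratmap C (N + N) (N + N)) :
  is_geometric_R R -> nondegenerate_map R.
Proof.
case=> prefix_R prod_R.
have [fstE sndE] := R_coord x_neq0 D_xy_neq0
  (fun i => ratmap_neq0 R (lshift N i)) prefix_R prod_R.
split; first exact: R_birational.
move=> z z_neq0; split.
  exists (fst_slice z_neq0); split; last exact: fst_slice_birational.
  move=> i; rewrite [fst_part R i]fstE; exact: fst_slice_composite.
exists (snd_slice z_neq0); split; last exact: snd_slice_birational.
move=> i; rewrite [snd_part R i]sndE; exact: snd_slice_composite.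
Qed.
End GeometricR.
End Substitution.

Theorem proposition3p2 (RR : realType) (n : nat) (hn : (1 <= n)%N)
    (R : ratmap (complex RR) (n + n) (n + n)) :
  is_geometric_R R -> nondegenerate_map R.
Proof.
by case: n hn R => // m _ R; exact: geometric_R_nondegenerate.
Qed.
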